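(* Let $k$ be a field and $n\ge1$, let $A=\Lambda^1(\widetilde{A_n})$, and let $e=e_v$ be the idempotent at any vertex $v$ of $\widetilde{A_n}$. Then the Satake map $$Z(A)\to eAe,\qquad z\mapsto ez,$$ is an isomorphism.
   Context: $\widetilde{A_n}$ is the quiver which is a cycle with $n+1$ vertices and $n+1$ arrows; $Z(A)$ denotes the center of $A$. For a finite quiver $Q$, let $\overline{Q}$ be its double (reverse arrow $a^*$ added for each $a\in Q_1$, $(a^* )^*=a$), $\epsilon(a)=1$ for $a\in Q_1$, $-1$ otherwise; $L_Q=k\overline{Q}[(1+aa^* )^{-1}]_{a\in\overline{Q}_1}$; for a fixed total order on $\overline{Q}_1$, $\rho=\prod_{a\in\overline{Q}_1}(1+aa^* )^{\epsilon(a)}$. Then $\Lambda^1(Q)=L_Q/(\rho-1)$ (parameter $q=(1,\dots,1)$). Its isomorphism class is independent of orientation and ordering. *)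

(* Defs.v *)
From HB Require Import structures.
From mathcomp Require Import all_boot all_algebra.
From mathcomp Require Import boolp finmap monalg.

Set Implicit Arguments.
Unset Strict Implicit.
Unset Printing Implicit Defensive.

Import GRing.Theory.
Local Open Scope ring_scope.
Local Open Scope quotient_scope.

(* Unital associative k-algebras, possibly zero, given by a central structure *)
(* map k -> B.  The library's algType only covers nonzero rings, whereas a    *)
(* quotient by a two-sided ideal may vanish.                                  *)
HB.mixin Record PzRing_isKAlgebra (k : fieldType) B of GRing.PzRing B := {
  scal : k -> B;
  scalB : {morph scal : c d / c - d};
  scalM : {morph scal : c d / c * d};
  scal1 : scal 1 = 1;
  scal_comm : forall (c : k) (x : B), scal c * x = x * scal c
}.

#[short(type="kalgType")]
HB.structure Definition KAlgebra (k : fieldType) :=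
  {B of GRing.PzRing B & PzRing_isKAlgebra k B}.

Section IdealQuotient.
Context {k : fieldType} {B : kalgType k} (R : B -> Prop).

(* the two-sided ideal generated by R *)
Inductive in_ideal : B -> Prop :=
| in_ideal_gen r : R r -> in_ideal r
| in_ideal0 : in_ideal 0
| in_idealD x y : in_ideal x -> in_ideal y -> in_ideal (x + y)
| in_idealMl u x : in_ideal x -> in_ideal (u * x)
| in_idealMr u x : in_ideal x -> in_ideal (x * u).

Lemma in_idealN x : in_ideal x -> in_ideal (- x).
Proof. by rewrite -mulN1r; apply: in_idealMl. Qed.

Definition eq_mod_ideal (x y : B) : bool := `[< in_ideal (x - y) >].

Lemma eq_mod_ideal_is_equiv : equiv_class_of eq_mod_ideal.
Proof.
split=> [x|x y|y x z]; rewrite /eq_mod_ideal.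
- by apply/asboolP; rewrite subrr; apply: in_ideal0.
- by apply/asboolP/asboolP => /in_idealN; rewrite opprB.
- move=> /asboolP Hxy /asboolP Hyz; apply/asboolP.
  by rewrite -(subrKA y); apply: in_idealD.
Qed.
Canonical eq_mod_ideal_equiv := EquivRelPack eq_mod_ideal_is_equiv.

Definition quot := {eq_quot eq_mod_ideal}.
HB.instance Definition _ := Choice.on quot.
HB.instance Definition _ := EqQuotient.on quot.

Definition quot_pi (x : B) : quot := \pi_quot x.

Lemma quot_piP x y : quot_pi x = quot_pi y <-> in_ideal (x - y).
Proof.
rewrite /quot_pi; split=> [/eqP|H].
  by rewrite piE => /asboolP.
by apply/eqP; rewrite piE; apply/asboolP.
Qed.

Definition quot_zero : quot := quot_pi 0.
Definition quot_one : quot := quot_pi 1.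
Definition quot_opp (x : quot) : quot := quot_pi (- repr x).
Definition quot_add (x y : quot) : quot := quot_pi (repr x + repr y).
Definition quot_mul (x y : quot) : quot := quot_pi (repr x * repr y).

Lemma quot_ind (P : quot -> Prop) :
  (forall x, P (quot_pi x)) -> forall x, P x.
Proof. by move=> H x; rewrite -[x]reprK; apply: H. Qed.

Lemma repr_quot_pi x : in_ideal (repr (quot_pi x) - x).
Proof. by apply/quot_piP; rewrite /quot_pi reprK. Qed.

Lemma quot_oppE x : quot_opp (quot_pi x) = quot_pi (- x).
Proof.
by apply/quot_piP; rewrite -opprD; apply/in_idealN/repr_quot_pi.
Qed.

Lemma quot_addE x y : quot_add (quot_pi x) (quot_pi y) = quot_pi (x + y).
Proof.
apply/quot_piP; rewrite opprD addrACA.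
by apply: in_idealD; apply: repr_quot_pi.
Qed.

Lemma quot_mulE x y : quot_mul (quot_pi x) (quot_pi y) = quot_pi (x * y).
Proof.
apply/quot_piP; set x' := repr _; set y' := repr _.
have -> : x' * y' - x * y = (x' - x) * y' + x * (y' - y).
  by rewrite mulrBl mulrBr subrKA.
by apply: in_idealD; [apply: in_idealMr|apply: in_idealMl];
  apply: repr_quot_pi.
Qed.

Let quotE := (quot_oppE, quot_addE, quot_mulE).

Fact quot_addA : associative quot_add.
Proof. by do 3!elim/quot_ind=> ?; rewrite !quotE addrA. Qed.
Fact quot_addC : commutative quot_add.
Proof. by do 2!elim/quot_ind=> ?; rewrite !quotE addrC. Qed.
Fact quot_add0 : left_id quot_zero quot_add.
Proof. by elim/quot_ind=> ?; rewrite !quotE add0r. Qed.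
Fact quot_addN : left_inverse quot_zero quot_opp quot_add.
Proof. by elim/quot_ind=> ?; rewrite !quotE addNr. Qed.
HB.instance Definition _ :=
  GRing.isZmodule.Build quot quot_addA quot_addC quot_add0 quot_addN.

Fact quot_mulA : associative quot_mul.
Proof. by do 3!elim/quot_ind=> ?; rewrite !quotE mulrA. Qed.
Fact quot_mul1l : left_id quot_one quot_mul.
Proof. by elim/quot_ind=> ?; rewrite !quotE mul1r. Qed.
Fact quot_mul1r : right_id quot_one quot_mul.
Proof. by elim/quot_ind=> ?; rewrite !quotE mulr1. Qed.
Fact quot_mulDl : left_distributive quot_mul quot_add.
Proof. by do 3!elim/quot_ind=> ?; rewrite !quotE mulrDl. Qed.
Fact quot_mulDr : right_distributive quot_mul quot_add.
Proof. by do 3!elim/quot_ind=> ?; rewrite !quotE mulrDr. Qed.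
HB.instance Definition _ := GRing.Zmodule_isPzRing.Build quot
  quot_mulA quot_mul1l quot_mul1r quot_mulDl quot_mulDr.

Fact quot_pi_is_zmod_morphism : zmod_morphism quot_pi.
Proof.
by move=> x y; rewrite /GRing.add /GRing.opp /= quot_oppE quot_addE.
Qed.
HB.instance Definition _ :=
  GRing.isZmodMorphism.Build B quot quot_pi quot_pi_is_zmod_morphism.
Fact quot_pi_is_monoid_morphism : monoid_morphism quot_pi.
Proof. by split=> // x y; rewrite /GRing.mul /= quot_mulE. Qed.
HB.instance Definition _ :=
  GRing.isMonoidMorphism.Build B quot quot_pi quot_pi_is_monoid_morphism.

Definition quot_scal (c : k) : quot := quot_pi (scal c).
Fact quot_scalB : {morph quot_scal : c d / c - d}.
Proof. by move=> c d; rewrite /quot_scal scalB rmorphB. Qed.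
Fact quot_scalM : {morph quot_scal : c d / c * d}.
Proof. by move=> c d; rewrite /quot_scal scalM rmorphM. Qed.
Fact quot_scal1 : quot_scal 1 = 1.
Proof. by rewrite /quot_scal scal1 rmorph1. Qed.
Fact quot_scal_comm c (x : quot) : quot_scal c * x = x * quot_scal c.
Proof. by elim/quot_ind: x => x; rewrite -!rmorphM scal_comm. Qed.
HB.instance Definition _ := PzRing_isKAlgebra.Build k quot
  quot_scalB quot_scalM quot_scal1 quot_scal_comm.

End IdealQuotient.

Arguments quot {k B} R.
Arguments quot_pi {k B} R x.

Section FreeAlgebra.
Context (k : fieldType) (X : choiceType).

Definition free_alg := {malg k[{fmonom X}]}.
HB.instance Definition _ := GRing.Lalgebra.on free_alg.

Definition free_scal (c : k) : free_alg := malgC c.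
Fact free_scalB : {morph free_scal : c d / c - d}.
Proof. exact: rmorphB. Qed.
Fact free_scalM : {morph free_scal : c d / c * d}.
Proof. exact: rmorphM. Qed.
Fact free_scal1 : free_scal 1 = 1.
Proof. exact: rmorph1. Qed.
Fact free_scal_comm c (x : free_alg) : free_scal c * x = x * free_scal c.
Proof.
rewrite /free_scal /malgC !malgM_def fgmulUg fgmulgU.
by apply: eq_bigr => m _; rewrite mul1m mulm1 mulrC.
Qed.
HB.instance Definition _ := PzRing_isKAlgebra.Build k free_alg
  free_scalB free_scalM free_scal1 free_scal_comm.

Definition free_gen (x : X) : free_alg := mkmalgU (fmu x) 1.

End FreeAlgebra.

Arguments free_gen {k X} x.

(* Universal localisation: the algebra obtained from B by freely adjoining    *)
(* two-sided inverses of the elements s i.  It is presented on the disjoint   *)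
(* union of B, subject to the relations that make B -> localization a         *)
(* morphism of algebras, and of I, the i-th generator being inverse to s i.   *)
Section Localization.
Context {k : fieldType} {B : kalgType k} {I : choiceType} (s : I -> B).

Local Notation free := (free_alg k (B + I)%type).
Local Notation base b := (@free_gen k (B + I)%type (inl b)).
Local Notation inv i := (@free_gen k (B + I)%type (inr i)).

Inductive loc_rel : free -> Prop :=
| loc_relD b b' : loc_rel (base (b + b') - (base b + base b'))
| loc_relM b b' : loc_rel (base (b * b') - base b * base b')
| loc_rel_scal c : loc_rel (base (scal c) - scal c)
| loc_relVr i : loc_rel (base (s i) * inv i - 1)
| loc_relVl i : loc_rel (inv i * base (s i) - 1).

Definition localization := quot loc_rel.
HB.instance Definition _ := KAlgebra.on localization.

Definition loc_base (b : B) : localization := quot_pi loc_rel (base b).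
Definition loc_inv (i : I) : localization := quot_pi loc_rel (inv i).

End Localization.

Record quiver := Quiver {
  vertex : finType;
  arrow : finType;
  source : arrow -> vertex;
  target : arrow -> vertex
}.

(* Paths are composed from left to right: a * b is nonzero only if            *)
(* target a = source b.                                                       *)
Section PathAlgebra.
Context (k : fieldType) (Q : quiver).

Local Notation free := (free_alg k (vertex Q + arrow Q)%type).
Local Notation idem v :=
  (@free_gen k (vertex Q + arrow Q)%type (inl v)).
Local Notation arr a :=
  (@free_gen k (vertex Q + arrow Q)%type (inr a)).

Inductive path_rel : free -> Prop :=
| path_rel_sum : path_rel (\sum_v idem v - 1)
| path_rel_idem v : path_rel (idem v * idem v - idem v)
| path_rel_orth v w : v != w -> path_rel (idem v * idem w)
| path_rel_source a : path_rel (idem (source a) * arr a - arr a)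
| path_rel_target a : path_rel (arr a * idem (target a) - arr a).

Definition path_alg := quot path_rel.
HB.instance Definition _ := KAlgebra.on path_alg.

Definition path_vertex (v : vertex Q) : path_alg := quot_pi path_rel (idem v).
Definition path_arrow (a : arrow Q) : path_alg := quot_pi path_rel (arr a).

End PathAlgebra.

(* inl a is the arrow a of Q, and inr a its reverse *)
Definition double_quiver (Q : quiver) : quiver :=
  @Quiver (vertex Q) (arrow Q + arrow Q)%type
    (fun a => match a with inl b => source b | inr b => target b end)
    (fun a => match a with inl b => target b | inr b => source b end).

Definition star {Q : quiver} (a : arrow (double_quiver Q)) : arrow (double_quiver Q) :=
  match a with inl b => inr b | inr b => inl b end.

Section MultiplicativePreprojective.
Context (k : fieldType) (Q : quiver) (le : rel (arrow (double_quiver Q))).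

Definition one_plus_aastar (a : arrow (double_quiver Q)) : path_alg k (double_quiver Q) :=
  1 + path_arrow k a * path_arrow k (star a).

(* L_Q *)
Definition loc_path_alg := localization one_plus_aastar.
HB.instance Definition _ := KAlgebra.on loc_path_alg.

(* (1 + a a^* ) ^ epsilon(a) *)
Definition rho_factor (a : arrow (double_quiver Q)) : loc_path_alg :=
  match a with
  | inl _ => loc_base one_plus_aastar (one_plus_aastar a)
  | inr _ => loc_inv one_plus_aastar a
  end.

Definition rho : loc_path_alg :=
  \prod_(a <- sort le (enum (arrow (double_quiver Q)))) rho_factor a.

(* Lambda^1(Q), where the total order on the arrows of the double is le *)
Definition mult_preproj := quot (fun x : loc_path_alg => x = rho - 1).
HB.instance Definition _ := KAlgebra.on mult_preproj.

Definition mp_vertex (v : vertex Q) : mult_preproj :=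
  quot_pi _ (loc_base one_plus_aastar (path_vertex k (Q := double_quiver Q) v)).

Lemma mp_vertex_idem v : mp_vertex v * mp_vertex v = mp_vertex v.
Proof.
rewrite /mp_vertex -rmorphM; congr quot_pi.
rewrite /loc_base -rmorphM; set e := path_vertex _ _.
have ee : e * e = e.
  rewrite /e /path_vertex -rmorphM; apply/quot_piP.
  exact/in_ideal_gen/path_rel_idem.
rewrite -[in RHS]ee; apply/esym/quot_piP; exact/in_ideal_gen/loc_relM.
Qed.

End MultiplicativePreprojective.

(* The cycle with n + 1 vertices and n + 1 arrows, the arrow i joining the    *)
(* vertices i and i + 1 modulo n + 1; it points from i to i + 1 if o i, and   *)
(* from i + 1 to i otherwise.                                                 *)
Definition cycle_quiver (n : nat) (o : 'I_n.+1 -> bool) : quiver :=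
  @Quiver 'I_n.+1 'I_n.+1
    (fun i => if o i then i else ordS i)
    (fun i => if o i then ordS i else i).

Section Center.
Context {k : fieldType} (A : kalgType k).

Definition central : {pred A} := fun x => `[< forall y : A, x * y = y * x >].

Lemma centralP (x : A) : reflect (forall y, x * y = y * x) (x \in central).
Proof. exact: asboolP. Qed.

Fact central_subring_closed : subring_closed central.
Proof.
split=> [|x y /centralP xC /centralP yC|x y /centralP xC /centralP yC];
  apply/centralP => z.
- by rewrite mul1r mulr1.
- by rewrite mulrBl mulrBr xC yC.
- by rewrite -mulrA yC mulrA xC mulrA.
Qed.

Record center_of := Center { center_val : A; _ : center_val \in central }.
HB.instance Definition _ := [isSub for center_val].
HB.instance Definition _ := [Choice of center_of by <:].
HB.instance Definition _ := GRing.SubChoice_isSubPzRing.Build A central center_of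
  central_subring_closed.

Fact scal_central (c : k) : (scal c : A) \in central.
Proof. by apply/centralP => x; apply: scal_comm. Qed.
Definition center_scal (c : k) : center_of := Center (scal_central c).
Fact center_scalB : {morph center_scal : c d / c - d}.
Proof. by move=> c d; apply: val_inj; rewrite [RHS]raddfB /= scalB. Qed.
Fact center_scalM : {morph center_scal : c d / c * d}.
Proof. by move=> c d; apply: val_inj; rewrite [RHS]rmorphM /= scalM. Qed.
Fact center_scal1 : center_scal 1 = 1.
Proof. by apply: val_inj; rewrite rmorph1 /= scal1. Qed.
Fact center_scal_comm c (x : center_of) : center_scal c * x = x * center_scal c.
Proof. by apply: val_inj; rewrite !rmorphM /= scal_comm. Qed.
HB.instance Definition _ := PzRing_isKAlgebra.Build k center_of
  center_scalB center_scalM center_scal1 center_scal_comm.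

End Center.

Record idempotent_of {k : fieldType} (A : kalgType k) := Idempotent {
  idem_val : A;
  idem_mul : idem_val * idem_val = idem_val
}.

(* e A e is a subgroup of A, closed under products, with unit element e. *)
Section Corner.
Context {k : fieldType} {A : kalgType k} (ie : idempotent_of A).
Let e : A := idem_val ie.

Let ee : e * e = e := idem_mul ie.

Definition in_corner : {pred A} := fun x => `[< exists y : A, x = e * y * e >].

Lemma in_cornerP (x : A) : reflect (exists y, x = e * y * e) (x \in in_corner).
Proof. exact: asboolP. Qed.

Record corner := Corner { corner_val : A; _ : corner_val \in in_corner }.
HB.instance Definition _ := [isSub for corner_val].
HB.instance Definition _ := [Choice of corner by <:].

Fact in_corner_zmod_closed : zmod_closed in_corner.
Proof.
split=> [|x y /in_cornerP[x' ->] /in_cornerP[y' ->]]; apply/in_cornerP.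
  by exists 0; rewrite mulr0 mul0r.
by exists (x' - y'); rewrite mulrBr mulrBl.
Qed.
HB.instance Definition _ := GRing.SubChoice_isSubZmodule.Build A in_corner corner
  in_corner_zmod_closed.

Fact corner_mull (x : corner) : e * val x = val x.
Proof. by have /in_cornerP[y ->] := valP x; rewrite !mulrA ee. Qed.
Fact corner_mulr (x : corner) : val x * e = val x.
Proof. by have /in_cornerP[y ->] := valP x; rewrite -mulrA ee. Qed.

Fact corner_one_subproof : e \in in_corner.
Proof. by apply/in_cornerP; exists 1; rewrite mulr1 ee. Qed.
Fact corner_mul_subproof (x y : corner) : val x * val y \in in_corner.
Proof.
apply/in_cornerP; exists (val x * val y).
by rewrite mulrA corner_mull -mulrA corner_mulr.
Qed.
Fact corner_scal_subproof (c : k) : scal c * e \in in_corner.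
Proof.
by apply/in_cornerP; exists (scal c); rewrite -scal_comm -mulrA ee.
Qed.

Definition corner_one : corner := Corner corner_one_subproof.
Definition corner_mul (x y : corner) : corner := Corner (corner_mul_subproof x y).
Definition corner_scal (c : k) : corner := Corner (corner_scal_subproof c).

Fact corner_mulA : associative corner_mul.
Proof. by move=> x y z; apply: val_inj; rewrite /= mulrA. Qed.
Fact corner_mul1l : left_id corner_one corner_mul.
Proof. by move=> x; apply: val_inj; apply: corner_mull. Qed.
Fact corner_mul1r : right_id corner_one corner_mul.
Proof. by move=> x; apply: val_inj; apply: corner_mulr. Qed.
Fact cornerD (x y : corner) :
  corner_val (x + y) = corner_val x + corner_val y.
Proof. exact: (raddfD val). Qed.
Fact corner_mulDl : left_distributive corner_mul +%R.
Proof. move=> x y z; apply: val_inj; rewrite [RHS]cornerD /=.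
by rewrite [X in X * _]cornerD mulrDl. Qed.
Fact corner_mulDr : right_distributive corner_mul +%R.
Proof. move=> x y z; apply: val_inj; rewrite [RHS]cornerD /=.
by rewrite [X in _ * X]cornerD mulrDr. Qed.
HB.instance Definition _ := GRing.Zmodule_isPzRing.Build corner
  corner_mulA corner_mul1l corner_mul1r corner_mulDl corner_mulDr.

Fact corner_scalB : {morph corner_scal : c d / c - d}.
Proof.
by move=> c d; apply: val_inj; rewrite [RHS]raddfB /= scalB mulrBl.
Qed.
Fact corner_scalM : {morph corner_scal : c d / c * d}.
Proof.
move=> c d; apply: val_inj => /=.
by rewrite scalM -[RHS]mulrA (mulrA e) -(scal_comm d e) -(mulrA _ e) ee mulrA.
Qed.
Fact corner_scal1 : corner_scal 1 = 1.
Proof. by apply: val_inj; rewrite /= scal1 mul1r. Qed.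
Fact corner_scal_comm c (x : corner) : corner_scal c * x = x * corner_scal c.
Proof.
apply: val_inj => /=.
by rewrite -mulrA corner_mull mulrA -scal_comm -mulrA corner_mulr.
Qed.
HB.instance Definition _ := PzRing_isKAlgebra.Build k corner
  corner_scalB corner_scalM corner_scal1 corner_scal_comm.

End Corner.

Definition mp_idempotent (k : fieldType) (Q : quiver)
    (le : rel (arrow (double_quiver Q))) (v : vertex Q) :
    idempotent_of (mult_preproj k le) :=
  Idempotent (mp_vertex_idem k le v).

(* Main.v *)
Require Import Defs.
From HB Require Import structures.
From mathcomp Require Import all_boot all_algebra.
From mathcomp Require Import perm boolp finmap monalg.

Set Implicit Arguments.
Unset Strict Implicit.
Unset Printing Implicit Defensive.

Import GRing.Theory.
Local Open Scope ring_scope.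

(* Let x_i : i -> i + 1 and y_i : i + 1 -> i be the two arrows of the double   *)
(* over the edge i.  If x_i is an arrow of Q put Y_i = y_i, and otherwise put  *)
(* Y_i = - (1 + y_i x_i)^-1 y_i.  Then 1 + x_i Y_i and (1 + Y_i x_i)^-1 are    *)
(* the factors of rho at i and at i + 1 for every orientation.  As a product   *)
(* of two factors with value 1 may be reordered, for every order rho = 1 means *)
(* that x_(i+1) Y_(i+1) = Y_i x_i for all i.                                   *)
(* Hence x = sum x_i and y = sum Y_i commute, e_i x = x e_(i+1),               *)
(* e_(i+1) y = y e_i, the element 1 + xy is central and invertible, and up to  *)
(* a power of 1 + xy every element is a combination of the e_i x^d y^e.        *)
(* The representation sending x to a times the cyclic shift and y to b times   *)
(* its inverse, over the field k(a, b), maps e_i x^d y^e applied to the vector *)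
(* (1, ..., 1) to a^d b^e times the i-th basis vector; hence it is faithful,   *)
(* and y is not a zero divisor.                                                *)
(* If z is central and e_i z = 0 then (e_(i+1) z) y = y (e_i z) = 0, so        *)
(* e_(i+1) z = 0 and finally z = 0.  Conversely a monomial x^d y^e with        *)
(* e_v x^d y^e e_v <> 0 preserves all the vertices, so it is central, and      *)
(* these monomials times e_v span e_v A e_v over k[(1 + xy)^-1].               *)

(** * Quotients, free algebras and subalgebras *)

(** For every orientation and every order of the arrows the relations take one shape, recorded in
    [cyclic_presentation]: vertex idempotents, commuting [x] and [y] that rotate the vertices in
    opposite directions, and an inverse [u] of 1 + xy. It is reached in [cycle_presentation]:
    [prod_factor_eq1] splits rho = 1 into one equation per vertex, and [cycle_relation] rewrites
    that equation as the commutation of [x] and [y] at that vertex.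

    Surjectivity uses the presentation alone. By [normalizable_all] every element is a combination
    of monomials after multiplication by a power of the central unit 1 + xy; the monomials that
    survive in a corner are central up to the idempotent, and [corner_lift_central] removes the
    idempotent.

    Injectivity carries the vanishing of a central element from one vertex to the next, which
    requires [y] to be right regular. The relations do not show this directly; it is read off a
    representation by matrices over a field, constructed in [mp_cycle_rep] and proved faithful in
    [rep_inj]. Both halves meet in [satake_bijective]. *)

Section QuotientMorphism.
Context {k : fieldType} {B : kalgType k} (R : B -> Prop) (S : pzRingType).
Context (g : {rmorphism B -> S}) (gR : forall r, R r -> g r = 0).

Lemma rmorph_in_ideal x : in_ideal R x -> g x = 0.
Proof.
elim=> [r /gR //||{}x y _ gx _ gy|a {}x _ gx|a {}x _ gx].
- exact: rmorph0.
- by rewrite rmorphD gx gy addr0.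
- by rewrite rmorphM gx mulr0.
- by rewrite rmorphM gx mul0r.
Qed.

Lemma quot_lift : exists h : {rmorphism quot R -> S},
  forall b, h (quot_pi R b) = g b.
Proof.
pose h (x : quot R) := g (repr x).
have hE b : h (quot_pi R b) = g b.
  apply/eqP; rewrite -subr_eq0 -rmorphB; apply/eqP/rmorph_in_ideal.
  exact: repr_quot_pi.
have hB : zmod_morphism h.
  by elim/(@quot_ind _ _ R)=> a; elim/(@quot_ind _ _ R)=> b;
    rewrite -rmorphB !hE rmorphB.
have hM : monoid_morphism h.
  split; first by rewrite -(rmorph1 (quot_pi R)) hE rmorph1.
  by elim/(@quot_ind _ _ R)=> a; elim/(@quot_ind _ _ R)=> b;
    rewrite -rmorphM !hE rmorphM.
pose hh := HB.pack_for {rmorphism quot R -> S} h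
  (GRing.isZmodMorphism.Build _ _ h hB) (GRing.isMonoidMorphism.Build _ _ h hM).
by exists hh.
Qed.

End QuotientMorphism.

Section FreeLift.
Context {k : fieldType} {X : choiceType} {S : nzRingType}.
Context (c : {rmorphism k -> S}) (cC : forall a s, GRing.comm (c a) s).
Context (h : X -> S).

Let ev (m : {fmonom X}) : S := \prod_(x <- (m : seq X)) h x.

Fact ev_mmorphism : mmorphism ev.
Proof. by split=> [m1 m2|]; rewrite /ev ?fmM ?big_cat ?fm1 ?big_nil. Qed.

(** The target is a ring with a central map from k, not a k-algebra, so that it can be a matrix ring
    over an extension F of k. *)
Lemma free_lift : exists g : {rmorphism free_alg k X -> S},
  (forall a, g (scal a) = c a) /\ (forall x, g (free_gen x) = h x).
Proof.
pose evm := HB.pack_for {mmorphism {fmonom X} -> S} ev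
  (isMultiplicative.Build _ _ ev ev_mmorphism).
have gM : monoid_morphism (mmap c evm).
  have [gM g1] := commr_mmap_is_multiplicative (h := evm) (f := c)
    (fun g m m' => cC _ _).
  by split.
pose g := HB.pack_for {rmorphism free_alg k X -> S} (mmap c evm)
  (GRing.isZmodMorphism.Build _ _ _ (mmap_is_additive (f := c) (h := evm)))
  (GRing.isMonoidMorphism.Build _ _ _ gM).
exists g; split=> [a|x]; rewrite /g /=.
- by rewrite [LHS](mmapC (f := c) (h := evm)).
- rewrite /free_gen [LHS](mmapU (f := c)).
  by rewrite [X in X * _](rmorph1 c) mul1r /ev fmU big_seq1.
Qed.

End FreeLift.

Section Subalgebra.
Context {k : fieldType}.

Section ScalMorphism.
Context (A : kalgType k).
HB.instance Definition _ := GRing.isZmodMorphism.Build k A scal scalB.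
HB.instance Definition _ :=
  GRing.isMonoidMorphism.Build k A scal (conj scal1 scalM).
End ScalMorphism.

(** Generation is phrased as induction: a predicate of this kind that holds on the generators holds
    everywhere. No span has to be formed. *)
Record subalgebra (A : kalgType k) (P : A -> Prop) : Prop := Subalgebra {
  subalgebra_scal : forall c, P (scal c);
  subalgebraD : forall x y, P x -> P y -> P (x + y);
  subalgebraM : forall x y, P x -> P y -> P (x * y)
}.

Context {A : kalgType k} {P : A -> Prop} (subP : subalgebra P).

Lemma subalgebra1 : P 1.
Proof. by rewrite -(scal1 (k := k)); apply: subalgebra_scal. Qed.

Lemma subalgebra0 : P 0.
Proof. by rewrite -(rmorph0 (scal : k -> A)); apply: subalgebra_scal. Qed.

Lemma subalgebraN x : P x -> P (- x).
Proof.
move=> Px; rewrite -mulN1r -[- 1]sub0r -(scal1 (k := k)).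
rewrite -(rmorph0 (scal : k -> A)) -rmorphB.
by apply: subalgebraM => //; apply: subalgebra_scal.
Qed.

Lemma subalgebra_free (X : choiceType) (g : {rmorphism free_alg k X -> A}) :
    (forall c, g (scal c) = scal c) -> (forall x, P (g (free_gen x))) ->
  forall b, P (g b).
Proof.
move=> gc gx b.
have -> : b = \sum_(m <- msupp b) scal b@_m * \prod_(x <- (m : seq X)) free_gen x.
  rewrite [LHS]monalgE; apply: eq_bigr => m _.
  have -> : \prod_(x <- (m : seq X)) free_gen x = << 1 *g m >> :> free_alg k X.
    rewrite -[m in RHS]fmK; case: m => s; elim: s => [|x s IHs] /=.
      by rewrite big_nil -fmoneE.
    rewrite big_cons IHs /free_gen.
    rewrite [LHS](fgmulUU (R := k)) mulr1; congr mkmalgU.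
    by apply: val_inj; rewrite /= fmM fmU.
  by rewrite [RHS](fgmulUU (R := k)) mulr1 mul1m.
rewrite rmorph_sum; elim/big_ind: _ => [||m _]; first exact: subalgebra0.
  exact: subalgebraD.
rewrite rmorphM gc; apply: subalgebraM => //; first exact: subalgebra_scal.
rewrite rmorph_prod; elim/big_ind: _ => [||x _]; first exact: subalgebra1.
  exact: subalgebraM.
exact: gx.
Qed.

End Subalgebra.

(** * Localizations and path algebras *)

Section LocalizationTheory.
Context {k : fieldType} {B : kalgType k} {I : choiceType} (s : I -> B).

Lemma loc_base_is_zmod_morphism : zmod_morphism (loc_base s).
Proof.
have baseD b b' : loc_base s (b + b') = loc_base s b + loc_base s b'.
  rewrite /loc_base -rmorphD; apply/quot_piP.
  exact/in_ideal_gen/loc_relD.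
by move=> b b'; apply: (addIr (loc_base s b')); rewrite -baseD !subrK.
Qed.
HB.instance Definition _ := GRing.isZmodMorphism.Build B (localization s)
  (loc_base s) loc_base_is_zmod_morphism.

Lemma loc_base_scal c : loc_base s (scal c) = scal c.
Proof. apply/quot_piP; exact/in_ideal_gen/loc_rel_scal. Qed.

Lemma loc_base_is_monoid_morphism : monoid_morphism (loc_base s).
Proof.
split=> [|b b']; first by rewrite -(scal1 (k := k)) loc_base_scal scal1.
rewrite /loc_base -rmorphM; apply/quot_piP.
exact/in_ideal_gen/loc_relM.
Qed.
HB.instance Definition _ := GRing.isMonoidMorphism.Build B (localization s)
  (loc_base s) loc_base_is_monoid_morphism.

Lemma loc_invr i : loc_base s (s i) * loc_inv s i = 1.
Proof.
rewrite /loc_base /loc_inv -rmorphM -(rmorph1 (quot_pi _)); apply/quot_piP.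
exact/in_ideal_gen/loc_relVr.
Qed.

Lemma loc_invl i : loc_inv s i * loc_base s (s i) = 1.
Proof.
rewrite /loc_base /loc_inv -rmorphM -(rmorph1 (quot_pi _)); apply/quot_piP.
exact/in_ideal_gen/loc_relVl.
Qed.

Lemma loc_lift (S : nzRingType) (c : {rmorphism k -> S}) (g : {rmorphism B -> S})
    (t : I -> S) : (forall a x, GRing.comm (c a) x) ->
    (forall a, g (scal a) = c a) ->
    (forall i, g (s i) * t i = 1) -> (forall i, t i * g (s i) = 1) ->
  exists h : {rmorphism localization s -> S},
    (forall b, h (loc_base s b) = g b) /\ (forall i, h (loc_inv s i) = t i).
Proof.
move=> cC gc gt tg.
have [h0 [h0c h0g]] := @free_lift _ (B + I)%type _ c cC
  (fun x => match x with inl b => g b | inr i => t i end).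
have [r [b b'|b b'|a|i|i]|h hE] := @quot_lift _ _ (loc_rel s) _ h0.
- by rewrite rmorphB rmorphD !h0g rmorphD subrr.
- by rewrite rmorphB rmorphM !h0g rmorphM subrr.
- by rewrite rmorphB h0g h0c gc subrr.
- by rewrite rmorphB rmorphM !h0g gt rmorph1 subrr.
- by rewrite rmorphB rmorphM !h0g tg rmorph1 subrr.
by exists h; split=> [b|i]; rewrite [LHS]hE h0g.
Qed.

Lemma subalgebra_loc (A : kalgType k) (P : A -> Prop)
    (g : {rmorphism localization s -> A}) : subalgebra P ->
    (forall c, g (scal c) = scal c) -> (forall b, P (g (loc_base s b))) ->
    (forall i, P (g (loc_inv s i))) ->
  forall x, P (g x).
Proof.
move=> subP gc gb gi; elim/(@quot_ind _ _ (loc_rel s))=> x.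
apply: (subalgebra_free subP (g := g \o quot_pi (loc_rel s)))=> [c|[b|i]].
- exact: gc.
- exact: gb.
- exact: gi.
Qed.

End LocalizationTheory.

Section PathAlgebraTheory.
Context {k : fieldType} {Q : quiver}.

Local Notation pe := (path_vertex k (Q := Q)).
Local Notation pa := (path_arrow k (Q := Q)).

Lemma path_vertex_sum : \sum_v pe v = 1.
Proof.
rewrite -(rmorph1 (quot_pi _)) -rmorph_sum; apply/quot_piP.
exact/in_ideal_gen/path_rel_sum.
Qed.

Lemma path_vertex_mul v w : pe v * pe w = if v == w then pe v else 0.
Proof.
have [<-|vw] := eqVneq v w; rewrite -rmorphM.
  apply/quot_piP; exact/in_ideal_gen/path_rel_idem.
rewrite -(rmorph0 (quot_pi _)); apply/quot_piP; rewrite subr0.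
exact/in_ideal_gen/path_rel_orth.
Qed.

Lemma path_source a : pe (source a) * pa a = pa a.
Proof. rewrite -rmorphM; apply/quot_piP; exact/in_ideal_gen/path_rel_source. Qed.

Lemma path_target a : pa a * pe (target a) = pa a.
Proof. rewrite -rmorphM; apply/quot_piP; exact/in_ideal_gen/path_rel_target. Qed.

Lemma path_lift (S : nzRingType) (c : {rmorphism k -> S})
    (e : vertex Q -> S) (t : arrow Q -> S) : (forall a x, GRing.comm (c a) x) ->
    \sum_v e v = 1 -> (forall v w, e v * e w = if v == w then e v else 0) ->
    (forall a, e (source a) * t a = t a) -> (forall a, t a * e (target a) = t a) ->
  exists h : {rmorphism path_alg k Q -> S},
    [/\ forall a, h (scal a) = c a, forall v, h (pe v) = e v
      & forall a, h (pa a) = t a].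
Proof.
move=> cC e1 ee es et.
have [h0 [h0c h0g]] := @free_lift _ (vertex Q + arrow Q)%type _ c cC
  (fun x => match x with inl v => e v | inr a => t a end).
have [r [|v|v w /negbTE vw|a|a]|h hE] := @quot_lift _ _ (@path_rel k Q) _ h0.
- rewrite rmorphB rmorph_sum rmorph1 -e1; apply/eqP; rewrite subr_eq0; apply/eqP.
  by apply: eq_bigr => v _; rewrite h0g.
- by rewrite rmorphB rmorphM !h0g ee eqxx subrr.
- by rewrite rmorphM !h0g ee vw.
- by rewrite rmorphB rmorphM !h0g es subrr.
- by rewrite rmorphB rmorphM !h0g et subrr.
by exists h; split=> [a|v|a]; rewrite [LHS]hE ?h0g ?h0c.
Qed.

Lemma subalgebra_path (A : kalgType k) (P : A -> Prop)
    (g : {rmorphism path_alg k Q -> A}) : subalgebra P ->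
    (forall c, g (scal c) = scal c) -> (forall v, P (g (pe v))) ->
    (forall a, P (g (pa a))) ->
  forall x, P (g x).
Proof.
move=> subP gc ge ga; elim/(@quot_ind _ _ (@path_rel k Q))=> x.
apply: (subalgebra_free subP (g := g \o quot_pi (@path_rel k Q)))=> [c|[v|a]].
- exact: gc.
- exact: ge.
- exact: ga.
Qed.

End PathAlgebraTheory.

(** * Multiplicative preprojective algebras *)

Lemma inverse_unique (S : pzRingType) (a b b' : S) :
  b * a = 1 -> a * b' = 1 -> b = b'.
Proof. by move=> ba ab'; rewrite -[b]mulr1 -ab' mulrA ba mul1r. Qed.

Lemma inverse_comm (S : pzRingType) (a b e : S) :
  a * b = 1 -> b * a = 1 -> e * a = a * e -> e * b = b * e.
Proof.
move=> ab ba ea; rewrite -[LHS]mul1r -ba -!mulrA; congr (b * _).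
by rewrite mulrA -ea -mulrA ab mulr1.
Qed.

Section DoubleQuiverFactors.
Context {Q : quiver} {S : pzRingType}.
Local Notation arr := (arrow (double_quiver Q)).
Local Notation src := (@source (double_quiver Q)).
Local Notation tgt := (@target (double_quiver Q)).
Context (e : vertex Q -> S) (t w : arr -> S).

(** The image of a factor of rho under an assignment of the generators. It lives in an arbitrary
    ring so that it serves both the algebra itself and its matrix representation. *)
Definition factor (a : arr) : S :=
  if a is inl _ then 1 + t a * t (star a) else w a.

Definition double_relations :=
  [/\ \sum_v e v = 1,
      forall u v, e u * e v = if u == v then e u else 0,
      forall a, e (src a) * t a = t a,
      forall a, t a * e (tgt a) = t a
    & forall a, (1 + t a * t (star a)) * w a = 1
             /\ w a * (1 + t a * t (star a)) = 1].

Hypothesis rels : double_relations.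
Let ee := let: And5 _ h _ _ _ := rels in h.
Let es := let: And5 _ _ h _ _ := rels in h.
Let et := let: And5 _ _ _ h _ := rels in h.
Let ww := let: And5 _ _ _ _ h := rels in h.

Lemma vertex_arrow v a : e v * t a = if v == src a then t a else 0.
Proof.
by rewrite -es mulrA ee; case: eqP => [->|_]; rewrite ?mul0r.
Qed.

Lemma arrow_vertex v a : t a * e v = if tgt a == v then t a else 0.
Proof. by rewrite -et -mulrA ee; case: eqP; rewrite ?mulr0. Qed.

Lemma target_star a : tgt (star a) = src a.
Proof. by case: a. Qed.

Lemma vertex_aastar v a : e v * (t a * t (star a)) =
  if v == src a then t a * t (star a) else 0.
Proof. by rewrite mulrA vertex_arrow; case: eqP; rewrite ?mul0r. Qed.

Lemma aastar_vertex v a : t a * t (star a) * e v =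
  if v == src a then t a * t (star a) else 0.
Proof.
rewrite -mulrA arrow_vertex target_star eq_sym.
by case: eqP; rewrite ?mulr0.
Qed.

Lemma one_aastar_comm v a :
  e v * (1 + t a * t (star a)) = (1 + t a * t (star a)) * e v.
Proof. by rewrite mulrDr mulrDl mulr1 mul1r vertex_aastar aastar_vertex. Qed.

Lemma aastar_inv_comm v a : e v * w a = w a * e v.
Proof.
by have [] := ww a => h1 h2; apply: inverse_comm h1 h2 (one_aastar_comm v a).
Qed.

Lemma factor_comm v a : e v * factor a = factor a * e v.
Proof.
by case: a => a; [apply: (one_aastar_comm v (inl a)) | apply: aastar_inv_comm].
Qed.

Lemma factor_off v a : src a != v -> e v * factor a = e v.
Proof.
rewrite eq_sym => /negbTE va.
have e1 : e v * (1 + t a * t (star a)) = e v.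
  by rewrite mulrDr mulr1 vertex_aastar va addr0.
case: a va e1 => a va e1 //=.
by rewrite -{1}e1 -mulrA (ww _).1 mulr1.
Qed.

Lemma prod_factor_at v (l : seq arr) :
  e v * (\prod_(a <- l) factor a) = e v * (\prod_(a <- l | src a == v) factor a).
Proof.
elim: l => [|a l IHl]; first by rewrite !big_nil.
rewrite !big_cons; case: ifPn => [_|/factor_off fa]; last by rewrite mulrA fa.
by rewrite !mulrA factor_comm -!mulrA IHl.
Qed.

(** Each factor commutes with the vertex idempotents and acts as 1 away from the source of its
    arrow. Hence rho = 1 is a local condition at each vertex, in which only the arrows starting
    there occur. *)
Lemma prod_factor_eq1 (l : seq arr) : (\prod_(a <- l) factor a = 1) <->
  (forall v, e v * (\prod_(a <- l | src a == v) factor a) = e v).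
Proof.
split=> [h v|h]; first by rewrite -prod_factor_at h mulr1.
have [e1 _ _ _ _] := rels.
rewrite -[LHS]mul1r -[X in X * _]e1 mulr_suml -[RHS]e1; apply: eq_bigr => v _.
by rewrite prod_factor_at.
Qed.

End DoubleQuiverFactors.

Section MultiplicativePreprojectiveTheory.
Context {k : fieldType} {Q : quiver} (le : rel (arrow (double_quiver Q))).
Local Notation A := (mult_preproj k le).
Local Notation L := (one_plus_aastar k (Q := Q)).
Local Notation arr := (arrow (double_quiver Q)).
Local Notation mp_rel := (fun x : loc_path_alg k Q => x = rho k le - 1).

Definition mp_base : path_alg k (double_quiver Q) -> A :=
  quot_pi mp_rel \o loc_base L.
HB.instance Definition _ := GRing.RMorphism.copy mp_base
  (quot_pi mp_rel \o loc_base L).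

Definition mp_arrow (a : arr) : A :=
  mp_base (path_arrow k (Q := double_quiver Q) a).
Definition mp_inv (a : arr) : A := quot_pi mp_rel (loc_inv L a).

Lemma mp_base_scal c : mp_base (scal c) = scal c.
Proof. by rewrite /mp_base /= loc_base_scal. Qed.

Lemma mp_relations : double_relations (mp_vertex k le) mp_arrow mp_inv.
Proof.
split=> [|u v|a|a|a].
- rewrite -(rmorph1 mp_base) -(path_vertex_sum (Q := double_quiver Q)).
  by rewrite rmorph_sum.
- rewrite -[LHS](rmorphM mp_base) path_vertex_mul.
  by case: eqP => // _; rewrite rmorph0.
- by rewrite -[LHS](rmorphM mp_base) path_source.
- by rewrite -[LHS](rmorphM mp_base) path_target.
- have -> : 1 + mp_arrow a * mp_arrow (star a) = mp_base (L a).
    by rewrite rmorphD rmorph1 rmorphM.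
  split; rewrite -[LHS](rmorphM (quot_pi mp_rel)).
    by rewrite loc_invr rmorph1.
  by rewrite loc_invl rmorph1.
Qed.

Lemma mp_factor (a : arr) :
  quot_pi mp_rel (rho_factor k a) = factor mp_arrow mp_inv a.
Proof. by case: a => a //; rewrite -[LHS]/(mp_base _) rmorphD rmorph1 rmorphM. Qed.

Lemma mp_rho : \prod_(a <- sort le (enum arr)) factor mp_arrow mp_inv a = 1.
Proof.
under eq_bigr do rewrite -mp_factor.
rewrite -rmorph_prod -(rmorph1 (quot_pi mp_rel)); apply/quot_piP.
exact: in_ideal_gen.
Qed.

Lemma mp_lift (S : nzRingType) (c : {rmorphism k -> S})
    (e : vertex Q -> S) (t w : arr -> S) : (forall a x, GRing.comm (c a) x) ->
    double_relations e t w ->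
    \prod_(a <- sort le (enum arr)) factor t w a = 1 ->
  exists h : {rmorphism A -> S},
    [/\ forall a, h (scal a) = c a, forall v, h (mp_vertex k le v) = e v,
      forall a, h (mp_arrow a) = t a & forall a, h (mp_inv a) = w a].
Proof.
move=> cC [e1 ee es et ww] rho1.
have [h0 [h0c h0e h0t]] := path_lift (Q := double_quiver Q) cC e1 ee es et.
have h0L a : h0 (L a) = 1 + t a * t (star a).
  by rewrite rmorphD rmorphM rmorph1 !h0t.
have [a|a|h1 [h1b h1w]] := @loc_lift _ _ _ L _ c h0 w cC h0c.
- by rewrite h0L (ww a).1.
- by rewrite h0L (ww a).2.
have [_ ->|h hE] := @quot_lift _ _ mp_rel _ h1.
  rewrite rmorphB rmorph1 rmorph_prod; apply/eqP; rewrite subr_eq0; apply/eqP.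
  by rewrite -[RHS]rho1; apply: eq_bigr => -[a|a] _ /=; rewrite ?h1b ?h0L ?h1w.
exists h; split=> [a|v|a|a].
- by rewrite -mp_base_scal [LHS]hE h1b h0c.
- by rewrite [LHS]hE h1b h0e.
- by rewrite [LHS]hE h1b h0t.
- by rewrite [LHS]hE h1w.
Qed.

Lemma subalgebra_mp (P : A -> Prop) : subalgebra P ->
    (forall v, P (mp_vertex k le v)) -> (forall a, P (mp_arrow a)) ->
    (forall a, P (mp_inv a)) ->
  forall x, P x.
Proof.
move=> subP Pe Pa Pw; elim/(@quot_ind _ _ mp_rel)=> x.
apply: (subalgebra_loc subP (g := quot_pi mp_rel)) => // b.
by apply: (subalgebra_path subP (g := mp_base)) => // c; apply: mp_base_scal.
Qed.

End MultiplicativePreprojectiveTheory.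

(** * The cyclic presentation *)

Lemma cycle_ind (n : nat) (P : 'I_n.+1 -> Prop) (v : 'I_n.+1) :
  P v -> (forall w, P w -> P (ordS w)) -> forall w, P w.
Proof.
move=> Pv PS w.
have iterP j : P (iter j (@ordS n.+1) v) by elim: j => //= j /PS.
(* Adding n + 1 before subtracting v keeps the truncated subtraction exact and changes nothing
   modulo n + 1. *)
suff -> : w = iter (w + n.+1 - v)%N (@ordS n.+1) v by [].
apply: val_inj => /=.
have -> j : val (iter j (@ordS n.+1) v) = ((v + j) %% n.+1)%N.
  elim: j => [|j IHj] /=; first by rewrite addn0 modn_small.
  by rewrite IHj -addn1 modnDml addn1 addnS.
by rewrite subnKC ?modnDr ?modn_small // (leq_trans (ltnW (ltn_ord v))) ?leq_addl.
Qed.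

Section CyclicPresentation.
Context {k : fieldType} {n : nat} {A : kalgType k}.
Context (E : 'I_n.+1 -> A) (x y u : A).

(** Relations and generation only: linear independence of the monomials is not included and comes
    later from the representation. *)
Record cyclic_presentation : Prop := CyclicPresentation {
  cyc_sum : \sum_i E i = 1;
  cyc_idem : forall i j, E i * E j = if i == j then E i else 0;
  cyc_x : forall i, E i * x = x * E (ordS i);
  cyc_y : forall i, E (ordS i) * y = y * E i;
  cyc_xy : x * y = y * x;
  cyc_ur : (1 + x * y) * u = 1;
  cyc_ul : u * (1 + x * y) = 1;
  cyc_gen : forall P : A -> Prop, subalgebra P ->
    (forall i, P (E i)) -> P x -> P y -> P u -> forall z, P z
}.

Hypothesis pres : cyclic_presentation.

Lemma centralizer_subalgebra (a : A) : subalgebra (fun z => z * a = a * z).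
Proof.
split=> [c|z z' za z'a|z z' za z'a]; first exact: scal_comm.
  by rewrite mulrDl mulrDr za z'a.
by rewrite -mulrA z'a !mulrA za.
Qed.

(** The centralizer of [a] is a subalgebra, so generators suffice; [u] comes for free, being the
    inverse of 1 + xy. *)
Lemma cyc_central (a : A) : (forall i, E i * a = a * E i) -> x * a = a * x ->
  y * a = a * y -> forall z, z * a = a * z.
Proof.
move=> Ea xa ya; apply: (cyc_gen pres (centralizer_subalgebra a)) => //.
apply/esym/(inverse_comm (cyc_ur pres) (cyc_ul pres)).
by rewrite mulrDl mulrDr mul1r mulr1 -[X in _ = _ + X]mulrA ya !mulrA xa.
Qed.

Lemma cyc_T_central z : z * (1 + x * y) = (1 + x * y) * z.
Proof.
apply: cyc_central => [i||].
- rewrite mulrDr mulrDl mulr1 mul1r; congr (_ + _).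
  by rewrite mulrA (cyc_x pres) -mulrA (cyc_y pres) mulrA.
- rewrite mulrDr mulrDl mulr1 mul1r; congr (_ + _).
  by rewrite -mulrA -(cyc_xy pres).
- by rewrite mulrDr mulrDl mulr1 mul1r; congr (_ + _); rewrite mulrA -(cyc_xy pres).
Qed.

Lemma cyc_TX_central m z : z * (1 + x * y) ^+ m = (1 + x * y) ^+ m * z.
Proof. exact/commrX/cyc_T_central. Qed.

(** * Normal forms: combinations of monomials up to powers of 1 + xy *)

Local Notation term := (k * ('I_n.+1 * (nat * nat)))%type.
Definition mon (d : nat * nat) : A := x ^+ d.1 * y ^+ d.2.
Definition term_eval (q : term) : A := scal q.1 * (E q.2.1 * mon q.2.2).
Definition terms_eval (s : seq term) : A := \sum_(q <- s) term_eval q.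

Definition stable (a : A) := forall s, exists s', a * terms_eval s = terms_eval s'.

Lemma stable_term (a : A) :
  (forall q, exists s, a * term_eval q = terms_eval s) -> stable a.
Proof.
move=> aq; elim=> [|q s [s' IHs]].
  by exists [::]; rewrite /terms_eval !big_nil mulr0.
have [s1 qs1] := aq q; exists (s1 ++ s').
by rewrite /terms_eval big_cat big_cons mulrDr qs1 IHs.
Qed.

Lemma stable_subalgebra : subalgebra stable.
Proof.
split=> [c|a b sa sb s|a b sa sb s].
- apply: stable_term => -[d q]; exists [:: (c * d, q)].
  by rewrite /terms_eval big_seq1 /term_eval /= mulrA scalM.
- have [s1 h1] := sa s; have [s2 h2] := sb s; exists (s1 ++ s2).
  by rewrite mulrDl h1 h2 /terms_eval big_cat.
- have [s1 h1] := sb s; have [s2 h2] := sa s1; exists s2.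
  by rewrite -mulrA h1.
Qed.

Lemma stable_E i : stable (E i).
Proof.
apply: stable_term => -[c [j d]].
exists (if i == j then [:: (c, (j, d))] else [::]).
rewrite /terms_eval /term_eval /= mulrA -scal_comm -mulrA (mulrA (E i)).
rewrite (cyc_idem pres).
by have [->|_] := eqVneq i j; rewrite ?big_seq1 // big_nil mul0r mulr0.
Qed.

Lemma stable_x : stable x.
Proof.
apply: stable_term => -[c [j [d e]]]; exists [:: (c, (ord_pred j, (d.+1, e)))].
rewrite /terms_eval big_seq1 /term_eval /mon /= mulrA -scal_comm -mulrA.
by rewrite exprS -!mulrA (mulrA (E _) x) (cyc_x pres) ord_predK -!mulrA.
Qed.

Lemma cyc_yX d : y * x ^+ d = x ^+ d * y.
Proof. exact/commrX/esym/(cyc_xy pres). Qed.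

Lemma stable_y : stable y.
Proof.
apply: stable_term => -[c [j [d e]]]; exists [:: (c, (ordS j, (d, e.+1)))].
rewrite /terms_eval big_seq1 /term_eval /mon /= mulrA -scal_comm -mulrA.
rewrite exprS !mulrA -(mulrA _ _ y) -cyc_yX !mulrA -(mulrA _ y).
by rewrite -(cyc_y pres) mulrA.
Qed.

Definition normalizable (z : A) :=
  exists m s, (1 + x * y) ^+ m * z = terms_eval s.

Lemma stable_T : stable (1 + x * y).
Proof.
apply: (subalgebraD stable_subalgebra).
  exact: (subalgebra1 stable_subalgebra).
exact: (subalgebraM stable_subalgebra stable_x stable_y).
Qed.

Lemma stable_TX m : stable ((1 + x * y) ^+ m).
Proof.
elim: m => [|m IHm]; first exact: (subalgebra1 stable_subalgebra).
rewrite exprS; exact: (subalgebraM stable_subalgebra stable_T).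
Qed.

Lemma normalizable_stable a z : stable a -> normalizable z -> normalizable (a * z).
Proof.
move=> sa [m [s ms]]; have [s' ss'] := sa s; exists m, s'.
by rewrite mulrA -cyc_TX_central -mulrA ms.
Qed.

Lemma normalizableD z z' :
  normalizable z -> normalizable z' -> normalizable (z + z').
Proof.
move=> [m [s ms]] [m' [s' ms']].
have [s1 h1] := stable_TX m' s; have [s2 h2] := stable_TX m s'.
exists (m + m')%N, (s1 ++ s2).
rewrite mulrDr {1}addnC !exprD -!mulrA ms ms' h1 h2.
by rewrite /terms_eval big_cat.
Qed.

Lemma normalizable_all z : normalizable z.
Proof.
(* The induction is on left multiplication by z preserving [normalizable], a property visibly closed
   under products; it is then applied to 1, the sum of the idempotents. *)
suff: forall z', normalizable z' -> normalizable (z * z').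
  move=> /(_ 1); rewrite mulr1; apply.
  exists 0%N, [seq (1, (i, (0, 0)%N)) | i : 'I_n.+1].
  rewrite mulr1 expr0 -(cyc_sum pres) /terms_eval big_image /=.
  by apply: eq_bigr => i _; rewrite /term_eval /mon /= scal1 mul1r !mulr1.
apply: (cyc_gen pres (P := fun z => forall z',
    normalizable z' -> normalizable (z * z'))).
- split=> [c z'|a b Pa Pb z' nz'|a b Pa Pb z' nz'].
  + exact/normalizable_stable/(subalgebra_scal stable_subalgebra).
  + by rewrite mulrDl; apply: normalizableD; [apply: Pa|apply: Pb].
  + by rewrite -mulrA; apply/Pa/Pb.
- move=> i z'; exact/normalizable_stable/stable_E.
- move=> z'; exact/normalizable_stable/stable_x.
- move=> z'; exact/normalizable_stable/stable_y.
(* One more power of 1 + xy absorbs [u]. *)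
- move=> z' [m [s ms]]; exists m.+1, s.
  by rewrite exprSr -mulrA (mulrA _ u) (cyc_ur pres) mul1r.
Qed.

Lemma cyc_T_lreg m z : (1 + x * y) ^+ m * z = 0 -> z = 0.
Proof.
elim: m => [|m IHm]; first by rewrite mul1r.
rewrite exprS -mulrA => h; apply: IHm.
by rewrite -[LHS]mul1r -[X in X * _ = _](cyc_ul pres) -mulrA h mulr0.
Qed.

(** * Monomials as rotations of the vertices, and central lifts of corner elements *)

Definition shift (d : nat * nat) (i : 'I_n.+1) : 'I_n.+1 :=
  iter d.1 (@ord_pred n.+1) (iter d.2 (@ordS n.+1) i).

Lemma mon_E d i : mon d * E i = E (shift d i) * mon d.
Proof.
case: d => d e; rewrite /mon /shift /=.
have yE : y ^+ e * E i = E (iter e (@ordS n.+1) i) * y ^+ e.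
  elim: e => [|e IHe] /=; first by rewrite mul1r mulr1.
  by rewrite exprS -mulrA IHe mulrA -(cyc_y pres) mulrA.
rewrite -mulrA yE; elim: d => [|d IHd] /=; first by rewrite !mul1r.
rewrite exprS -!mulrA IHd (mulrA x) -{1}[iter d _ _]ord_predK.
by rewrite -(cyc_x pres) !mulrA.
Qed.

(** A shift is a rotation of the cycle and commutes with the successor, so one fixed vertex forces
    all of them to be fixed. *)
Lemma shift_fixed d v : shift d v = v -> forall w, shift d w = w.
Proof.
move=> dv; apply: (cycle_ind dv) => w dw.
rewrite -[in RHS]dw /shift -iterSr iterS.
elim: d.1 => //= m ->; by rewrite ordSK ord_predK.
Qed.

Lemma mon_central d v : shift d v = v -> forall z, z * mon d = mon d * z.
Proof.
move=> dv; apply: cyc_central => [i||].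
- by rewrite mon_E (shift_fixed dv).
- by rewrite /mon -[RHS]mulrA -(commrX d.2 (cyc_xy pres)) !mulrA -exprS -exprSr.
- by rewrite /mon mulrA cyc_yX -!mulrA -exprS -exprSr.
Qed.

Lemma corner_lift_central v c : E v * c * E v = c ->
  exists z, (forall w, w * z = z * w) /\ E v * z = c.
Proof.
move=> vc; have [m [s ms]] := normalizable_all c.
(* These are the terms of the normal form that survive multiplication by [E v] on both sides, with
   their idempotent dropped; that makes each of them central. The denominator is then cleared by
   [u ^+ m]. *)
pose f := \sum_(q <- s | (q.2.1 == v) && (shift q.2.2 v == v)) scal q.1 * mon q.2.2.
have fC w : w * f = f * w.
  rewrite mulr_sumr mulr_suml; apply: eq_bigr => q /andP[_ /eqP qv].
  by rewrite mulrA -scal_comm -[LHS]mulrA -[RHS]mulrA (mon_central qv).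
have uC w : w * u = u * w.
  exact: inverse_comm (cyc_ur pres) (cyc_ul pres) (cyc_T_central w).
have umC w : w * u ^+ m = u ^+ m * w by exact/commrX/uC.
exists (u ^+ m * f); split=> [w|]; first by rewrite mulrA umC -!mulrA fC.
have fs : E v * f = (1 + x * y) ^+ m * c.
  rewrite -[in RHS]vc -(mulrA (E v)) mulrA -cyc_TX_central -mulrA (mulrA _ c) ms.
  rewrite /terms_eval mulr_suml !mulr_sumr big_mkcond.
  apply: eq_bigr => -[a [i d]] _ /=.
  have -> : E v * (term_eval (a, (i, d)) * E v) =
      scal a * (E v * E i * E (shift d v) * mon d).
    rewrite /term_eval /= -(mulrA (scal a)) (mulrA (E v)) -scal_comm.
    rewrite -(mulrA _ (E v)).
    by rewrite -(mulrA (E i)) mon_E -(mulrA _ (E _)) -(mulrA (E v)).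
  rewrite !(cyc_idem pres) (eq_sym v).
  have [_|_] := eqVneq i v; last by rewrite !mul0r mulr0.
  rewrite (cyc_idem pres) eq_sym; case: eqP => _; last by rewrite mul0r mulr0.
  by rewrite mulrA -scal_comm -mulrA.
rewrite mulrA umC -mulrA fs mulrA.
have -> : u ^+ m * (1 + x * y) ^+ m = 1.
  by rewrite -exprMn_comm ?(cyc_ul pres) ?expr1n.
by rewrite mul1r.
Qed.

End CyclicPresentation.

(** * Faithful representations and the Satake map *)

Section CyclicRepresentation.
Context {k : fieldType} {n : nat} {A : kalgType k}.
Context (E : 'I_n.+1 -> A) (x y u : A) (pres : cyclic_presentation E x y u).
Context {F : fieldType} (iota : {rmorphism {poly {poly k}} -> F}).
Context (s : 'S_n.+1) (phi : {rmorphism A -> 'M[F]_n.+1}).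
Hypothesis iota_inj : injective iota.
Hypothesis phi_scal : forall c, phi (scal c) = (iota c%:P%:P)%:M.
Hypothesis phi_E : forall i, phi (E i) = delta_mx i i.
Hypothesis phi_x : phi x = iota 'X *: perm_mx s.
Hypothesis phi_y : phi y = iota 'X%:P *: perm_mx s^-1.

Local Notation one := (const_mx 1 : 'cV[F]_n.+1).
Local Notation term := (k * ('I_n.+1 * (nat * nat)))%type.

(** The outer variable stands for [x] and the inner one for [y]. *)
Definition term_poly (q : term) : {poly {poly k}} :=
  (q.1 *: 'X^(q.2.2.2)) *: 'X^(q.2.2.1).

(** Permutation matrices fix the all-ones vector, so a monomial acts on it through its scalar weight
    alone. *)
Lemma rep_mon d : phi (mon x y d) *m one = iota ('X^(d.1) * 'X%:P ^+ d.2) *: one.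
Proof.
have perm_one (r : 'S_n.+1) : perm_mx r *m one = one.
  by rewrite -row_permE; apply/matrixP => i j; rewrite !mxE.
have powE (a : A) c r m : phi a = iota c *: perm_mx r ->
    phi (a ^+ m) *m one = iota (c ^+ m) *: one.
  move=> ac; elim: m => [|m IHm]; first by rewrite !rmorph1 mul1mx scale1r.
  rewrite !exprS !rmorphM -mulmxE -mulmxA IHm ac.
  by rewrite -scalemxAr -scalemxAl perm_one scalerA mulrC.
rewrite /mon rmorphM -mulmxE -mulmxA (powE _ _ _ _ phi_y).
by rewrite -scalemxAr (powE _ _ _ _ phi_x) scalerA -rmorphM mulrC.
Qed.

Lemma rep_term (q : term) i :
  (phi (term_eval E x y q) *m one) i 0 =
    if q.2.1 == i then iota (term_poly q) else 0.
Proof.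
case: q => c [j [d e]]; rewrite /term_eval /term_poly /=.
rewrite rmorphM [X in _ * X]rmorphM -!mulmxE -!mulmxA rep_mon phi_scal phi_E /=.
rewrite mul_scalar_mx -!scalemxAr !mxE.
rewrite (bigD1 j) //= !mxE eqxx andbT big1; last first.
  by move=> l /negbTE lj; rewrite !mxE lj andbF mul0r.
rewrite addr0 mulr1 eq_sym; case: eqP => _; last by rewrite !mulr0.
rewrite mulr1 -rmorphM; congr (iota _).
by rewrite -!mul_polyC polyCM -(rmorphXn polyC) -[RHS]mulrA [in RHS](mulrC _ 'X^d).
Qed.

(** The coordinates of the image of the all-ones vector separate the vertices, and the two
    independent variables separate the exponents, so a vanishing image kills every coefficient. *)
Lemma terms_eval_rep0 l :
  phi (terms_eval E x y l) *m one = 0 -> terms_eval E x y l = 0.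
Proof.
move=> l0.
have sum_poly0 i : \sum_(q <- l | q.2.1 == i) term_poly q = 0.
  apply: iota_inj; rewrite rmorph0 rmorph_sum big_mkcond /=.
  have := congr1 (fun v : 'cV[F]_n.+1 => v i 0) l0.
  rewrite rmorph_sum mulmx_suml summxE mxE => e0; rewrite -[RHS]e0.
  by apply: eq_bigr => q _; rewrite rep_term.
have sum_coef0 d : \sum_(q <- l | q.2 == d) q.1 = 0.
  case: d => i [a b].
  have := congr1 (fun p : {poly {poly k}} => p`_a`_b) (sum_poly0 i).
  rewrite !coef_sum !coef0 => e0; rewrite -[RHS]e0.
  rewrite [LHS]big_mkcond [RHS]big_mkcond; apply: eq_bigr => -[c [j [a' b']]] _ /=.
  rewrite !xpair_eqE /term_poly /= coefZ coefXn; case: (j == i) => //=.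
  rewrite (eq_sym a'); case: (a == a') => /=; last by rewrite mulr0 coef0.
  rewrite mulr1 coefZ coefXn eq_sym.
  by case: (b == b'); rewrite ?mulr1 ?mulr0.
(* The list may repeat a monomial, so the sum is regrouped over the distinct ones, whose total
   coefficients vanish. *)
pose r := undup [seq q.2 | q <- l].
have termE (q : term) : q \in l ->
    term_eval E x y q = \sum_(d <- r | q.2 == d) scal q.1 * (E d.1 * mon x y d.2).
  move=> ql; rewrite big_mkcond (bigD1_seq q.2) ?mem_undup ?map_f ?undup_uniq //=.
  by rewrite eqxx big1 ?addr0 // => d; rewrite eq_sym => /negbTE ->.
rewrite /terms_eval (eq_big_seq _ termE) (exchange_big_dep predT) //=.
rewrite big1 // => d _.
by rewrite -mulr_suml -rmorph_sum sum_coef0 rmorph0 mul0r.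
Qed.

Lemma rep_inj z : phi z = 0 -> z = 0.
Proof.
move=> z0; have [m [l ml]] := normalizable_all pres z.
apply: (cyc_T_lreg pres (m := m)); rewrite ml; apply: terms_eval_rep0.
by rewrite -ml rmorphM z0 mulr0 mul0mx.
Qed.

Lemma cyc_y_rreg z : z * y = 0 -> z = 0.
Proof.
move=> zy; apply: rep_inj; move/(congr1 phi): zy.
rewrite rmorphM rmorph0 phi_y -mulmxE -scalemxAr => /eqP.
rewrite scaler_eq0 -(rmorph0 iota) (inj_eq iota_inj) polyC_eq0 polyX_eq0 /=.
move=> /eqP /(congr1 (mulmx^~ (perm_mx s))).
by rewrite -mulmxA -perm_mxM mulVg perm_mx1 mulmx1 mul0mx.
Qed.

Lemma central_corner_inj v z : (forall w, w * z = z * w) -> E v * z = 0 -> z = 0.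
Proof.
move=> zC vz; rewrite -[z]mul1r -(cyc_sum pres) mulr_suml big1 // => w _.
apply: (cycle_ind (v := v) (P := fun w => E w * z = 0)) => // i iz.
by apply: cyc_y_rreg; rewrite -mulrA -zC mulrA (cyc_y pres) -mulrA iz mulr0.
Qed.

Lemma satake_bijective (e : idempotent_of A) v : idem_val e = E v ->
  exists f : {rmorphism center_of A -> corner e},
    [/\ forall c : k, f (scal c) = scal c,
        forall z : center_of A, corner_val (f z) = idem_val e * center_val z
      & bijective f].
Proof.
move=> eE.
have zC (z : center_of A) w : w * center_val z = center_val z * w.
  by have /centralP -> := valP z.
have ee : idem_val e * idem_val e = idem_val e := idem_mul e.
have fP (z : center_of A) : idem_val e * center_val z \in in_corner e.
  by apply/in_cornerP; exists (center_val z); rewrite -mulrA -zC mulrA ee.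
pose f z := Corner (fP z).
have fB : zmod_morphism f.
  move=> z z'; apply: val_inj; rewrite [RHS](raddfB val) /= -mulrBr.
  by congr (_ * _); rewrite -[LHS]/(val (z - z')) raddfB.
have fM : monoid_morphism f.
  split=> [|z z']; apply: val_inj => /=.
    by rewrite mulr1.
  by rewrite -[RHS]mulrA [X in _ = _ * X]mulrA -(zC z) !mulrA ee.
pose ff := HB.pack_for {rmorphism center_of A -> corner e} f
  (GRing.isZmodMorphism.Build _ _ f fB) (GRing.isMonoidMorphism.Build _ _ f fM).
exists ff; split=> //.
  by move=> c; apply: val_inj; rewrite /= scal_comm.
have f_inj : injective ff.
  apply: raddf_inj => z /(congr1 val) /=.
  rewrite eE => z0; apply: val_inj; rewrite raddf0.
  exact: central_corner_inj (zC z) z0.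
have f_surj c : exists z, ff z = c.
  have [z [zC' zc]] : exists z, (forall w, w * z = z * w) /\ E v * z = val c.
    by apply: (corner_lift_central pres); rewrite -eE corner_mull corner_mulr.
  have zP : z \in @central k A by apply/centralP => w.
  by exists (Center zP); apply: val_inj; rewrite /= eE.
have [g gK] := boolp.choice f_surj.
by exists g => // z; apply: f_inj; rewrite gK.
Qed.

End CyclicRepresentation.

(** * The arrows of the double of a cycle *)

Section CycleQuiver.
Context {n : nat} (o : 'I_n.+1 -> bool).
Local Notation Q := (cycle_quiver o).
Local Notation arr := (arrow (double_quiver Q)).
Local Notation src := (@source (double_quiver Q)).
Local Notation tgt := (@target (double_quiver Q)).

Definition fwd (i : 'I_n.+1) : arr := if o i then inl i else inr i.
Definition bwd (i : 'I_n.+1) : arr := if o i then inr i else inl i.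

Lemma src_fwd i : src (fwd i) = i.
Proof. by rewrite /fwd; case: ifP => /= ->. Qed.
Lemma tgt_fwd i : tgt (fwd i) = ordS i.
Proof. by rewrite /fwd; case: ifP => /= ->. Qed.
Lemma src_bwd i : src (bwd i) = ordS i.
Proof. by rewrite /bwd; case: ifP => /= ->. Qed.
Lemma tgt_bwd i : tgt (bwd i) = i.
Proof. by rewrite /bwd; case: ifP => /= ->. Qed.
Lemma star_fwd i : star (fwd i) = bwd i.
Proof. by rewrite /fwd /bwd; case: ifP. Qed.
Lemma star_bwd i : star (bwd i) = fwd i.
Proof. by rewrite /fwd /bwd; case: ifP. Qed.

Variant arrow_spec : arr -> Prop :=
| ArrowFwd i : arrow_spec (fwd i)
| ArrowBwd i : arrow_spec (bwd i).

Lemma arrowP a : arrow_spec a.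
Proof.
case: a => i.
  have := (ArrowFwd i, ArrowBwd i); rewrite /fwd /bwd.
  by case: (o i) => [] [].
have := (ArrowFwd i, ArrowBwd i); rewrite /fwd /bwd.
by case: (o i) => [] [].
Qed.

(** Labels are compared rather than endpoints, since on a cycle with two vertices a forward and a
    backward arrow can share both endpoints. *)
Lemma fwd_neq_bwd i j : fwd i != bwd j.
Proof.
rewrite /fwd /bwd; have [<-|ij] := eqVneq i j; first by case: (o i).
by case: (o i) (o j) => [] [] //=; apply/eqP => -[] /eqP; rewrite (negbTE ij).
Qed.

Lemma filter_source (le : rel arr) i :
  perm_eq [seq a <- sort le (enum arr) | src a == ordS i] [:: fwd (ordS i); bwd i].
Proof.
apply: uniq_perm => [||a].
- by rewrite filter_uniq // sort_uniq enum_uniq.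
- by rewrite /= inE fwd_neq_bwd.
rewrite mem_filter mem_sort mem_enum andbT !inE.
have inj_fwd : injective fwd by move=> j l /(congr1 src); rewrite !src_fwd.
have inj_bwd : injective bwd by move=> j l /(congr1 tgt); rewrite !tgt_bwd.
case: (arrowP a) => j.
  by rewrite src_fwd (inj_eq inj_fwd) (negbTE (fwd_neq_bwd _ _)) orbF.
rewrite src_bwd (inj_eq inj_bwd) (inj_eq (can_inj (@ordSK n.+1))).
by rewrite eq_sym (eq_sym (bwd j)) (negbTE (fwd_neq_bwd _ _)) [LHS]eq_sym.
Qed.

Lemma perm_eq2 (T : eqType) (s : seq T) a b :
  perm_eq s [:: a; b] -> s = [:: a; b] \/ s = [:: b; a].
Proof.
move=> sab; have := perm_size sab; case: s sab => [|c [|d [|? ?]]] //= sab _.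
have d_eq t : perm_eq [:: d] [:: t] -> d = t.
  by move/perm_mem/(_ d); rewrite !inE eqxx => /esym/eqP.
have : c \in [:: a; b] by rewrite -(perm_mem sab) mem_head.
rewrite !inE => /orP[] /eqP ca; rewrite {}ca in sab *.
  by left; move: sab; rewrite perm_cons => /d_eq ->.
right; have := perm_trans sab (permEl (perm_catC [:: a] [:: b])).
by rewrite perm_cons => /d_eq ->.
Qed.
End CycleQuiver.

(** * The cyclic presentation of the algebra of a cycle *)

(** The element 1 + e(a - 1) is [a] on the part cut out by [e] and 1 on the complement, so inverses
    are taken part by part. *)
Lemma corner_unit_inverse (S : pzRingType) (e a b : S) :
  e * e = e -> e * a = a * e -> a * b = 1 -> b * a = 1 ->
  (1 + e * (a - 1)) * (1 + e * (b - 1)) = 1.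
Proof.
move=> ee ea ab ba; have eb := inverse_comm ab ba ea.
have cd : (b - 1) + (a - 1) + (a - 1) * (b - 1) = 0.
  rewrite mulrBr mulr1 mulrBl ab mul1r addrACA (subrr (a - 1)) addr0.
  by rewrite -opprB addNr.
have ce : (a - 1) * e = e * (a - 1) by rewrite mulrBr mulrBl ea mulr1 mul1r.
move: (a - 1) (b - 1) cd ce => c d cd ce.
rewrite mulrDl mul1r mulrDr mulr1 -mulrA (mulrA c) ce -(mulrA e c) mulrA ee.
by rewrite -addrA -!mulrDr addrA cd mulr0 addr0.
Qed.

Lemma woodbury_inverse (S : pzRingType) (p q v : S) :
  (1 + q * p) * v = 1 -> (1 + p * q) * (1 - p * v * q) = 1.
Proof.
move=> qpv; have pqp : (1 + p * q) * p = p * (1 + q * p).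
  by rewrite mulrDl mulrDr mul1r mulr1 mulrA.
by rewrite mulrBr mulr1 !mulrA pqp -(mulrA p) qpv mulr1 addrK.
Qed.

Section CyclePresentation.
Context {n : nat} {o : 'I_n.+1 -> bool} {k : fieldType} {A : kalgType k}.
Local Notation Q := (cycle_quiver o).
Local Notation arr := (arrow (double_quiver Q)).
Local Notation fwd := (fwd o).
Local Notation bwd := (bwd o).
Context (le : rel arr) (e : 'I_n.+1 -> A) (t w : arr -> A).
Hypothesis rels : double_relations (Q := Q) e t w.
Hypothesis rho1 : \prod_(a <- sort le (enum arr)) factor t w a = 1.
Hypothesis gen : forall P : A -> Prop, subalgebra P -> (forall i, P (e i)) ->
  (forall a, P (t a)) -> (forall a, P (w a)) -> forall z, P z.

Definition cyc_X i := t (fwd i).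
Definition cyc_Y i := if o i then t (bwd i) else - (w (bwd i) * t (bwd i)).
Local Notation X := cyc_X.
Local Notation Y := cyc_Y.

Let ee := let: And5 _ h _ _ _ := rels in h.
Let ww := let: And5 _ _ _ _ h := rels in h.

Lemma e_X j i : e j * X i = if j == i then X i else 0.
Proof. by rewrite /X (vertex_arrow rels) src_fwd. Qed.
Lemma X_e j i : X i * e j = if ordS i == j then X i else 0.
Proof. by rewrite /X (arrow_vertex rels) tgt_fwd. Qed.
Lemma e_Y j i : e j * Y i = if j == ordS i then Y i else 0.
Proof.
rewrite /Y; case: (o i); first by rewrite (vertex_arrow rels) src_bwd.
rewrite mulrN mulrA (aastar_inv_comm rels) -mulrA (vertex_arrow rels) src_bwd.
by case: eqP; rewrite ?mulr0 ?oppr0.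
Qed.
Lemma Y_e j i : Y i * e j = if i == j then Y i else 0.
Proof.
rewrite /Y; case: (o i); first by rewrite (arrow_vertex rels) tgt_bwd.
rewrite mulNr -mulrA (arrow_vertex rels) tgt_bwd.
by case: eqP; rewrite ?mulr0 ?oppr0.
Qed.

Lemma inv_bwdE i : ~~ o i -> w (bwd i) = 1 + Y i * X i.
Proof.
rewrite /Y => /negbTE ->; have := (ww (bwd i)).2; rewrite star_bwd mulrDr mulr1.
by move=> /(canRL (addrK _)) {1}->; rewrite mulNr mulrA.
Qed.

(** On a reversed edge the factor is an inverse (1 + xy)^-1, and the identity (1 + pq)^-1 = 1 - p (1
    + qp)^-1 q gives it the form 1 + xY. This is what dictates [cyc_Y]. *)
Lemma factor_fwd i : factor t w (fwd i) = 1 + X i * Y i.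
Proof.
case oi: (o i); first by rewrite /X /Y /fwd /bwd oi.
have [a1 a2] := ww (fwd i); have [b1 b2] := ww (bwd i).
have -> : factor t w (fwd i) = w (fwd i) by rewrite /fwd oi.
apply: (inverse_unique a2); rewrite star_fwd /Y oi mulrN mulrA.
by apply: woodbury_inverse; rewrite star_bwd in b1.
Qed.

Lemma bwd_factor_inv i : factor t w (bwd i) * (1 + Y i * X i) = 1
  /\ (1 + Y i * X i) * factor t w (bwd i) = 1.
Proof.
have [b1 b2] := ww (bwd i).
case oi: (o i).
  have -> : factor t w (bwd i) = w (bwd i) by rewrite /bwd oi.
  by rewrite /Y oi /X -star_bwd.
rewrite -inv_bwdE ?oi //.
have -> // : factor t w (bwd i) = 1 + t (bwd i) * t (star (bwd i)).
by rewrite /bwd oi.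
Qed.

(** At the vertex i + 1 only the forward factor 1 + X Y of the edge i + 1 and the inverse of 1 + Y X
    of the edge i remain. Their product is 1 there, in whichever order they occur. *)
Lemma cycle_relation i : X (ordS i) * Y (ordS i) = Y i * X i.
Proof.
have [fg gf] := bwd_factor_inv i; set g := 1 + Y i * X i in fg gf.
have eg : e (ordS i) * g = g * e (ordS i).
  exact: (inverse_comm fg gf (factor_comm rels _ _)).
have efg : e (ordS i) * factor t w (fwd (ordS i)) = e (ordS i) * g.
  have /(prod_factor_eq1 rels) /(_ (ordS i)) := rho1.
  rewrite -big_filter; case: (perm_eq2 (filter_source le i)) => ->.
    rewrite !big_cons big_nil mulr1 => efb.
    by rewrite -[in RHS]efb -!mulrA fg mulr1.
  rewrite !big_cons big_nil mulr1 mulrA (factor_comm rels) -mulrA => efb.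
  by rewrite eg -[in RHS]efb !mulrA gf mul1r.
move: efg; rewrite factor_fwd /g !mulrDr => /addrI.
by rewrite !mulrA e_X e_Y !eqxx.
Qed.

Definition cyc_gen_x := \sum_i X i.
Definition cyc_gen_y := \sum_i Y i.
Local Notation x := cyc_gen_x.
Local Notation y := cyc_gen_y.

Lemma e_x i : e i * x = X i.
Proof.
rewrite mulr_sumr (bigD1 i) //= e_X eqxx big1 ?addr0 // => j.
by rewrite e_X eq_sym => /negbTE ->.
Qed.

Lemma x_e i : x * e (ordS i) = X i.
Proof.
rewrite mulr_suml (bigD1 i) //= X_e eqxx big1 ?addr0 // => j.
by rewrite X_e (inj_eq (can_inj (@ordSK n.+1))) => /negbTE ->.
Qed.

Lemma e_y i : e (ordS i) * y = Y i.
Proof.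
rewrite mulr_sumr (bigD1 i) //= e_Y eqxx big1 ?addr0 // => j.
by rewrite e_Y (inj_eq (can_inj (@ordSK n.+1))) eq_sym => /negbTE ->.
Qed.

Lemma y_e i : y * e i = Y i.
Proof.
rewrite mulr_suml (bigD1 i) //= Y_e eqxx big1 ?addr0 // => j.
by rewrite Y_e => /negbTE ->.
Qed.

Lemma X_y i : X i * y = X i * Y i.
Proof.
have {1}-> : X i = X i * e (ordS i) by rewrite X_e eqxx.
by rewrite -mulrA e_y.
Qed.
Lemma Y_x i : Y i * x = Y i * X i.
Proof.
have {1}-> : Y i = Y i * e i by rewrite Y_e eqxx.
by rewrite -mulrA e_x.
Qed.

Lemma x_y_comm : x * y = y * x.
Proof.
rewrite [LHS]mulr_suml [RHS]mulr_suml.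
rewrite (reindex_inj (can_inj (@ordSK n.+1))) /=; apply: eq_bigr => i _.
by rewrite X_y Y_x cycle_relation.
Qed.

Lemma e_xy i : e i * (x * y) = X i * Y i.
Proof. by rewrite mulrA e_x X_y. Qed.

Lemma e_T_comm i : e i * (1 + x * y) = (1 + x * y) * e i.
Proof.
rewrite mulrDr mulrDl mulr1 mul1r; congr (_ + _).
by rewrite mulrA e_x -mulrA y_e -x_e -mulrA e_y.
Qed.

Definition fwd_factor_inv i := if o i then w (fwd i) else 1 + X i * t (bwd i).

Lemma fwd_factor_invP i : fwd_factor_inv i * (1 + X i * Y i) = 1
  /\ (1 + X i * Y i) * fwd_factor_inv i = 1.
Proof.
rewrite -factor_fwd /fwd_factor_inv; have [f1 f2] := ww (fwd i).
by move: f1 f2; rewrite star_fwd /X /fwd /bwd; case: (o i).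
Qed.

(** The inverse of 1 + xy, glued from the local inverses of 1 + X_i Y_i. *)
Definition cyc_gen_u := \sum_i e i * fwd_factor_inv i.
Local Notation u := cyc_gen_u.

Lemma e_fwd_inv i : e i * fwd_factor_inv i = fwd_factor_inv i * e i.
Proof.
have [h1 h2] := fwd_factor_invP i; apply: (inverse_comm h2 h1).
by rewrite -factor_fwd (factor_comm rels).
Qed.

Lemma e_T i : e i * (1 + x * y) = e i * (1 + X i * Y i).
Proof. by rewrite [LHS]mulrDr [RHS]mulrDr e_xy [in RHS]mulrA e_X eqxx. Qed.

Lemma T_u : (1 + x * y) * u = 1.
Proof.
have [e1 _ _ _ _] := rels; rewrite mulr_sumr -[RHS]e1; apply: eq_bigr => i _.
by rewrite mulrA -e_T_comm e_T -mulrA (fwd_factor_invP i).2 mulr1.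
Qed.

Lemma u_T : u * (1 + x * y) = 1.
Proof.
have [e1 _ _ _ _] := rels; rewrite mulr_suml -[RHS]e1; apply: eq_bigr => i _.
by rewrite e_fwd_inv -mulrA e_T mulrA -e_fwd_inv -mulrA (fwd_factor_invP i).1 mulr1.
Qed.

Lemma fwd_factor_T i : 1 + X i * Y i = 1 + e i * (1 + x * y - 1).
Proof. by rewrite [1 + x * y]addrC addrK e_xy. Qed.

Lemma T_factor_inv i : (1 + X i * Y i) * (1 + e i * (u - 1)) = 1.
Proof.
rewrite fwd_factor_T; apply: corner_unit_inverse; rewrite ?ee ?eqxx //.
- exact: e_T_comm.
- exact: T_u.
- exact: u_T.
Qed.

Lemma cycle_presentation : cyclic_presentation e x y u.
Proof.
split=> [|i j|i|i||||P subP Pe Px Py Pu].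
- by case: rels.
- exact: ee.
- by rewrite e_x x_e.
- by rewrite e_y y_e.
- exact: x_y_comm.
- exact: T_u.
- exact: u_T.
have P1 := subalgebra1 subP.
have PD := subalgebraD subP; have PM := subalgebraM subP.
have PX i : P (X i) by rewrite -e_x; apply: PM.
have PY i : P (Y i) by rewrite -y_e; apply: PM.
have PXY i : P (1 + X i * Y i) by apply/PD/PM.
have PN i : P (1 + e i * (u - 1)).
  by apply/PD/PM/PD/(subalgebraN subP).
have wN a i : 1 + t a * t (star a) = 1 + X i * Y i -> w a = 1 + e i * (u - 1).
  move=> aE; apply: (inverse_unique (ww a).2).
  by rewrite aE T_factor_inv.
(* On a reversed edge the change of variable is undone by y = - (1 + yx) Y, where 1 + yx is the
   inverse of 1 + Yx and is therefore expressed through [u]. *)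
have Pt_bwd i : P (t (bwd i)).
  case oi: (o i); first by move: (PY i); rewrite /Y oi.
  have [b1 _] := ww (bwd i); rewrite star_bwd in b1.
  have -> : t (bwd i) = - ((1 + t (bwd i) * X i) * Y i).
    by rewrite /Y oi mulrN opprK mulrA b1 mul1r.
  have -> : 1 + t (bwd i) * X i = 1 + e (ordS i) * (u - 1).
    apply: (inverse_unique b1); rewrite inv_bwdE ?oi // -cycle_relation.
    exact: T_factor_inv.
  by apply/(subalgebraN subP)/PM.
apply: gen => // a; case: (arrowP a) => i.
- exact: PX.
- exact: Pt_bwd.
- case oi: (o i).
    by rewrite (wN _ i) // -factor_fwd /fwd oi.
  have <- : factor t w (fwd i) = w (fwd i) by rewrite /fwd oi.
  by rewrite factor_fwd.
- case oi: (o i).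
    by rewrite (wN _ (ordS i)) // cycle_relation /Y oi star_bwd.
  by rewrite inv_bwdE ?oi // -cycle_relation.
Qed.

End CyclePresentation.

(** * The representation over k(a, b) *)

Section CycleRepresentation.
Context {n : nat} (o : 'I_n.+1 -> bool) {F : fieldType} (a b : F).
Local Notation Q := (cycle_quiver o).
Local Notation arr := (arrow (double_quiver Q)).
Local Notation src := (@source (double_quiver Q)).
Local Notation tgt := (@target (double_quiver Q)).
Local Notation T := (1 + a * b).
Hypotheses (a0 : a != 0) (T0 : T != 0).

Definition edge_weight i : F := if o i then T else T^-1.

(** Forward arrows have weight a; the weight of a backward arrow is forced by requiring the two
    weights over an edge to multiply to [edge_weight i - 1]. The choice T^-1 on reversed edges makes
    the modified generator Y_i have weight b for both orientations, as [rep_bwd] checks. *)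
Definition rep_weight (c : arr) : F :=
  match c with
  | inl i => if o i then a else (edge_weight i - 1) / a
  | inr i => if o i then (edge_weight i - 1) / a else a
  end.

Definition rep_diag i (c : F) : 'M[F]_n.+1 := 1 + (c - 1) *: delta_mx i i.

Definition rep_arrow (c : arr) : 'M[F]_n.+1 :=
  rep_weight c *: delta_mx (src c) (tgt c).

Definition rep_inv (c : arr) : 'M[F]_n.+1 :=
  rep_diag (src c) (edge_weight (match c with inl i => i | inr i => i end))^-1.

Lemma rep_diagM i c d : rep_diag i c * rep_diag i d = rep_diag i (c * d).
Proof.
rewrite /rep_diag mulrDl mul1r mulrDr mulr1 -mulmxE -scalemxAl -scalemxAr.
rewrite mul_delta_mx scalerA -addrA; congr (_ + _).
rewrite -!scalerDl; congr (_ *: _).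
by rewrite mulrBr mulr1 [X in _ + X]addrC subrK mulrBl mul1r addrC subrKA.
Qed.

Lemma rep_diag1 i : rep_diag i 1 = 1.
Proof. by rewrite /rep_diag subrr scale0r addr0. Qed.

Lemma edge_weight_neq0 i : edge_weight i != 0.
Proof. by rewrite /edge_weight; case: (o i); rewrite ?invr_eq0. Qed.

Lemma rep_aastar c : 1 + rep_arrow c * rep_arrow (star c) =
  rep_diag (src c) (edge_weight (match c with inl i => i | inr i => i end)).
Proof.
congr (_ + _); rewrite /rep_arrow -mulmxE -scalemxAl -scalemxAr scalerA.
case: c => i /=; rewrite mul_delta_mx; congr (_ *: _); case: (o i).
- by rewrite mulrC divfK.
- by rewrite divfK.
- by rewrite divfK.
- by rewrite mulrC divfK.
Qed.

Lemma rep_relations :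
  double_relations (Q := Q) (fun i => delta_mx i i) rep_arrow rep_inv.
Proof.
split=> [|i j|c|c|c].
- by rewrite -mx1_sum_delta.
- by rewrite -mulmxE mul_delta_mx_cond; case: eqP => [->|].
- by rewrite -mulmxE -scalemxAr mul_delta_mx.
- by rewrite -mulmxE -scalemxAl mul_delta_mx.
- rewrite rep_aastar /rep_inv !rep_diagM.
  by rewrite mulfV ?mulVf ?rep_diag1 ?edge_weight_neq0.
Qed.

Lemma rep_fwd i : rep_arrow (fwd o i) = a *: delta_mx i (ordS i).
Proof.
rewrite /rep_arrow src_fwd tgt_fwd; congr (_ *: _).
by rewrite /fwd; case oi: (o i); rewrite /= oi.
Qed.

Lemma rep_factor_fwd i : factor rep_arrow rep_inv (fwd o i) = rep_diag i T.
Proof.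
rewrite /fwd; case oi: (o i); rewrite /= ?rep_aastar /rep_inv /edge_weight /= oi //.
by rewrite invrK.
Qed.

Lemma rep_factor_bwd i :
  factor rep_arrow rep_inv (bwd o i) = rep_diag (ordS i) T^-1.
Proof.
by rewrite /bwd; case oi: (o i); rewrite /= ?rep_aastar /rep_inv /edge_weight /= oi.
Qed.

(** At each vertex the two remaining factors contribute T and T^-1, which cancel in either order. *)
Lemma rep_rho (le : rel arr) :
  \prod_(c <- sort le (enum arr)) factor rep_arrow rep_inv c = 1.
Proof.
apply/(prod_factor_eq1 rep_relations) => v; rewrite -(ord_predK v) -big_filter.
have TT := mulfV T0.
case: (perm_eq2 (filter_source le (ord_pred v))) => ->;
  rewrite !big_cons big_nil mulr1 rep_factor_fwd rep_factor_bwd rep_diagM.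
  by rewrite TT rep_diag1 mulr1.
by rewrite mulrC TT rep_diag1 mulr1.
Qed.

Lemma rep_diag_delta i j c d :
  rep_diag i c * (d *: delta_mx i j) = (c * d) *: delta_mx i j.
Proof.
rewrite /rep_diag mulrDl mul1r -mulmxE -scalemxAl -scalemxAr mul_delta_mx.
by rewrite scalerA -scalerDl mulrBl mul1r addrC subrK.
Qed.

Lemma rep_bwd i : (if o i then rep_arrow (bwd o i)
    else - (rep_inv (bwd o i) * rep_arrow (bwd o i))) = b *: delta_mx (ordS i) i.
Proof.
rewrite /rep_arrow /rep_inv src_bwd tgt_bwd rep_diag_delta /bwd.
case oi: (o i) => /=; rewrite oi /edge_weight oi.
  by rewrite addrAC subrr add0r mulrAC mulfV // mul1r.
rewrite invrK mulrA mulrBr mulr1 mulfV // opprD addrA subrr add0r.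
rewrite mulNr scaleNr opprK.
by rewrite mulrAC mulfV // mul1r.
Qed.

End CycleRepresentation.

Lemma mp_cycle_rep (k : fieldType) (n : nat) (o : 'I_n.+1 -> bool)
    (le : rel (arrow (double_quiver (cycle_quiver o)))) (F : fieldType)
    (iota : {rmorphism {poly {poly k}} -> F}) (s : 'S_n.+1) :
    injective iota -> (forall i, s i = ordS i) ->
  exists phi : {rmorphism mult_preproj k le -> 'M[F]_n.+1},
    [/\ forall c, phi (scal c) = (iota c%:P%:P)%:M,
        forall i, phi (mp_vertex k le i) = delta_mx i i,
        phi (cyc_gen_x (o := o) (mp_arrow le)) = iota 'X *: perm_mx s
      & phi (cyc_gen_y (o := o) (mp_arrow le) (mp_inv le)) =
          iota 'X%:P *: perm_mx s^-1].
Proof.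
move=> iota_inj sE.
have X0 : iota 'X != 0 by rewrite -(rmorph0 iota) (inj_eq iota_inj) polyX_eq0.
have T0 : 1 + iota 'X * iota 'X%:P != 0.
  rewrite -rmorphM -(rmorph1 iota) -rmorphD -(rmorph0 iota) (inj_eq iota_inj).
  (* Setting the outer variable to 0 turns 1 + ab into 1. *)
  apply/eqP => /(congr1 (fun p : {poly {poly k}} => p.[0])) /eqP.
  by rewrite !hornerE ?mul0r ?addr0 oner_eq0.
pose c : {rmorphism k -> 'M[F]_n.+1} :=
  GRing.RMorphism.clone _ _ (scalar_mx \o (iota \o (polyC \o polyC))) _.
have cC a x : GRing.comm (c a) x by rewrite /GRing.comm -mulmxE /= scalar_mxC.
have [phi [phi_c phi_e phi_t phi_w]] :=
  mp_lift cC (rep_relations o X0 T0) (rep_rho X0 T0 le).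
have delta_perm (r : 'S_n.+1) : perm_mx r = \sum_i delta_mx i (r i) :> 'M[F]_n.+1.
  apply/matrixP => i j; rewrite !mxE summxE (bigD1 i) //= !mxE eqxx /= eq_sym.
  by rewrite big1 ?addr0 // => l; rewrite !mxE eq_sym => /negbTE ->.
exists phi; split=> //.
- rewrite rmorph_sum delta_perm scaler_sumr; apply: eq_bigr => i _.
  by rewrite phi_t rep_fwd sE.
- rewrite rmorph_sum delta_perm scaler_sumr [RHS](reindex_inj (@perm_inj _ s)) /=.
  apply: eq_bigr => i _; rewrite permK sE -(rep_bwd o X0 T0) /cyc_Y.
  by case: (o i); rewrite ?rmorphN ?rmorphM ?phi_t ?phi_w.
Qed.

Theorem corollary6p14 (k : fieldType) (n : nat) (hn : (1 <= n)%N)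
    (o : 'I_n.+1 -> bool)
    (le : rel (arrow (double_quiver (cycle_quiver o))))
    (le_total : total le) (le_anti : antisymmetric le) (le_trans : transitive le)
    (v : vertex (cycle_quiver o)) :
  let A := mult_preproj k le in
  let e := mp_idempotent k le v in
  exists f : {rmorphism center_of A -> corner e},
    [/\ forall c : k, f (scal c) = scal c,
        forall z : center_of A, corner_val (f z) = idem_val e * center_val z
      & bijective f].
Proof.
(* The field is the fraction field of the polynomial ring in two variables, so both weights are
   nonzero and algebraically independent over k. *)
have frac_inj : injective (@tofrac {poly {poly k}}).
  by move=> p q /eqP; rewrite tofrac_eq => /eqP.
pose s : 'S_n.+1 := perm (can_inj (@ordSK n.+1)).
have sE i : s i = ordS i by rewrite permE.
have [phi [phi_c phi_e phi_x phi_y]] :=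
  @mp_cycle_rep k n o le _ (@tofrac {poly {poly k}}) s frac_inj sE.
have pres := cycle_presentation (mp_relations (k := k) le) (mp_rho le)
  (@subalgebra_mp _ _ le).
exact: (satake_bijective pres frac_inj phi_c phi_e phi_x phi_y
  (e := mp_idempotent k le v) (v := v) erefl).
Qed.
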